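(* Let $m,n\ge 2$ be integers, let $\mathbb{K}$ be a field and let $S=\mathbb{K}[x_{i,j}: i\in[m], j\in[n]]$. Let $\tau$ be the lexicographic order on $S$ induced by $x_{1,1}>x_{1,2}>\cdots>x_{1,n}>x_{2,1}>\cdots>x_{2,n}>\cdots>x_{m,1}>\cdots>x_{m,n}$. Let $\mathcal{J}_{K_m,P_n}\subseteq S$ be the ideal generated by the $2$-minors $[i,j\,|\,k,k+1]=x_{i,k}x_{j,k+1}-x_{i,k+1}x_{j,k}$ for $1\le i<j\le m$ and $k\in[n-1]$. Then $(\operatorname{in}_\tau(\mathcal{J}_{K_m,P_n}))^t=\operatorname{in}_\tau(\mathcal{J}_{K_m,P_n}^t)$ for all $t\ge 1$.
   Context: $\mathcal{J}_{K_m,P_n}$ is the generalized binomial edge ideal of the path graph $P_n$ on $[n]$ with edges $\{k,k+1\}$. $\operatorname{in}_\tau(I)$ denotes the initial ideal of $I$ with respect to $\tau$. *)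

(* Defs.v *)
From HB Require Import structures.
From mathcomp Require Import all_boot all_order all_algebra.
From mathcomp Require Import zify.
From mathcomp Require Import mpoly.
Set Implicit Arguments. Unset Strict Implicit. Unset Printing Implicit Defensive.
Import GRing.Theory.
Local Open Scope ring_scope.

(* Variables x_{i,j}, i : 'I_m, j : 'I_n (0-indexed), are the variables of
   {mpoly K[m*n]} with index i*n+j.  Smaller index = larger variable, so
   x_{1,1} > x_{1,2} > ... > x_{m,n} corresponds to index 0 > 1 > ... *)

Lemma vidx_proof (m n : nat) (i : 'I_m) (j : 'I_n) : (i * n + j < m * n)%N.
Proof. have := ltn_ord i; have := ltn_ord j; nia. Qed.

Definition vidx (m n : nat) (i : 'I_m) (j : 'I_n) : 'I_(m * n) :=
  Ordinal (vidx_proof i j).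

Definition xv (K : fieldType) (m n : nat) (i : 'I_m) (j : 'I_n)
  : {mpoly K[m * n]} := 'X_(vidx i j).
Arguments xv : clear implicits.

Definition lexlt (N : nat) (u v : 'X_{1..N}) : Prop :=
  exists k : 'I_N, (u k < v k)%N /\ (forall l : 'I_N, (l < k)%N -> u l = v l).

Definition is_lead (K : fieldType) (N : nat) (f : {mpoly K[N]}) (u : 'X_{1..N}) : Prop :=
  u \in msupp f /\ (forall v, v \in msupp f -> v = u \/ lexlt v u).

Definition gen_ideal (K : fieldType) (N : nat) (G : {mpoly K[N]} -> Prop)
  : {mpoly K[N]} -> Prop :=
  fun p => exists s : seq ({mpoly K[N]} * {mpoly K[N]}),
    (forall q, q \in s -> G q.2) /\ p = \sum_(q <- s) q.1 * q.2.

Definition ideal_pow (K : fieldType) (N : nat) (I : {mpoly K[N]} -> Prop) (t : nat)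
  : {mpoly K[N]} -> Prop :=
  gen_ideal (fun p => exists s : seq {mpoly K[N]},
    size s = t /\ (forall q, q \in s -> I q) /\ p = \prod_(q <- s) q).

Definition init_ideal (K : fieldType) (N : nat) (I : {mpoly K[N]} -> Prop)
  : {mpoly K[N]} -> Prop :=
  gen_ideal (fun p => exists f u, I f /\ f != 0 /\ is_lead f u /\ p = 'X_[u]).

Definition J_KP (K : fieldType) (m n : nat) : {mpoly K[m * n]} -> Prop :=
  gen_ideal (fun p => exists (i j : 'I_m) (k k1 : 'I_n),
    (i < j)%N /\ nat_of_ord k1 = k.+1 /\
    p = xv K m n i k * xv K m n j k1 - xv K m n i k1 * xv K m n j k).
Arguments J_KP : clear implicits.

(* Main.v *)
(* For i < j the leading term of the minor [i,j|k,k+1] is x_{i,k} x_{j,k+1}, and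
   these quadratic monomials are the edges of a bipartite graph on the variables
   (columns of even and odd index).

   The minors form a Groebner basis.  Call a monomial standard if no edge divides
   it.  Replacing one monomial of a minor by the other preserves the column
   degrees and, for every column c that is empty, the row degrees of the part to
   the left of c.  A standard monomial is the lex smallest one with given
   invariants, so summing coefficients over its class is a functional that
   vanishes on J but not on an f whose leading monomial is standard.

   Let f be in J^t with leading monomial u, and let C be a vertex cover.  If u had
   degree < t in the variables of C, then the Hasse derivatives of order u_x in
   the variables x of C would send f to an element of J whose leading monomial is
   u with the variables of C erased, which is standard: a contradiction.  So every
   vertex cover has u-weight at least t, and by Koenig's theorem u is divisible by
   a product of t edges, that is, it lies in in(J)^t. *)

Require Import Defs.
From HB Require Import structures.
From mathcomp Require Import all_boot all_order all_algebra.
From mathcomp Require Import zify mpoly.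
Set Implicit Arguments. Unset Strict Implicit. Unset Printing Implicit Defensive.
Import GRing.Theory.
Local Open Scope ring_scope.

(** * Powers of ideals and initial ideals *)

Section Ideals.
Variables (K : fieldType) (N : nat).
Implicit Types (p q r g : {mpoly K[N]}) (G I : {mpoly K[N]} -> Prop).

Lemma gen_ideal_ind G (P : {mpoly K[N]} -> Prop) :
  P 0 -> (forall p q, P p -> P q -> P (p + q)) ->
  (forall r g, G g -> P (r * g)) -> forall p, gen_ideal G p -> P p.
Proof.
move=> P0 PD PM p [s [sG ->]]; elim: s sG => [|q s IHs] sG; first by rewrite big_nil.
rewrite big_cons; apply: PD; first by apply/PM/sG; rewrite mem_head.
by apply: IHs => x xs; apply: sG; rewrite in_cons xs orbT.
Qed.

Lemma gen_ideal0 G : gen_ideal G 0.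
Proof. by exists [::]; split=> //; rewrite big_nil. Qed.

Lemma gen_idealD G p q : gen_ideal G p -> gen_ideal G q -> gen_ideal G (p + q).
Proof.
move=> [s [sG ->]] [s' [sG' ->]]; exists (s ++ s'); split; last by rewrite big_cat.
by move=> x; rewrite mem_cat => /orP[/sG|/sG'].
Qed.

Lemma gen_idealMl G r p : gen_ideal G p -> gen_ideal G (r * p).
Proof.
move=> [s [sG ->]]; exists [seq (r * x.1, x.2) | x <- s]; split.
  by move=> x /mapP[y /sG Gy ->].
by rewrite big_map mulr_sumr; apply: eq_bigr => x _; rewrite mulrA.
Qed.

Lemma gen_ideal_mem G g : G g -> gen_ideal G g.
Proof.
move=> Gg; exists [:: (1, g)]; split; last by rewrite big_seq1 mul1r.
by move=> x; rewrite inE => /eqP->.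
Qed.

Lemma gen_ideal_sum G (T : Type) (s : seq T) (P : pred T) (F : T -> {mpoly K[N]}) :
  (forall x, P x -> gen_ideal G (F x)) -> gen_ideal G (\sum_(x <- s | P x) F x).
Proof. by move=> GF; apply: big_ind => //; [exact: gen_ideal0 | exact: gen_idealD]. Qed.

Lemma ideal_pow0 I p : ideal_pow I 0 p.
Proof.
rewrite -[p]mulr1; apply/gen_idealMl/gen_ideal_mem.
by exists [::]; rewrite big_nil.
Qed.

Lemma ideal_powS I s g p : I g -> ideal_pow I s p -> ideal_pow I s.+1 (g * p).
Proof.
move=> Ig; apply: (gen_ideal_ind (P := fun p => ideal_pow I s.+1 (g * p))).
- by rewrite mulr0; exact: gen_ideal0.
- by move=> a b Ha Hb; rewrite mulrDr; apply: gen_idealD.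
move=> r _ [l [<- [lI ->]]]; rewrite mulrCA.
have -> : g * \prod_(q <- l) q = \prod_(q <- g :: l) q by rewrite big_cons.
apply/gen_idealMl/gen_ideal_mem; exists (g :: l); split=> //; split=> // x.
by rewrite in_cons => /predU1P[->|/lI].
Qed.

Lemma ideal_pow_le I s s' p : (s' <= s)%N -> ideal_pow I s p -> ideal_pow I s' p.
Proof.
move=> /subnKC <-; elim: (s - s')%N => [|d IHd]; first by rewrite addn0.
rewrite addnS => sp; apply: IHd; move: sp; apply: gen_ideal_ind.
- exact: gen_ideal0.
- by move=> a b; apply: gen_idealD.
move=> r _ [[|g l] [// [sz] [lI ->]]]; rewrite big_cons mulrA.
apply/gen_idealMl/gen_ideal_mem; exists l; split=> //; split=> // x xl.
by apply: lI; rewrite in_cons xl orbT.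
Qed.

Lemma ideal_pow_sub G s p : (0 < s)%N -> ideal_pow (gen_ideal G) s p -> gen_ideal G p.
Proof.
move=> s0 /(ideal_pow_le s0); apply: gen_ideal_ind.
- exact: gen_ideal0.
- by move=> a b; apply: gen_idealD.
move=> r _ [[|g [|? ?]] [// _ [lI ->]]]; rewrite big_seq1.
by apply/gen_idealMl/lI/mem_head.
Qed.

End Ideals.

(** * The lexicographic order and leading monomials *)

Section Lex.
Variable N : nat.
Implicit Types u v w : 'X_{1..N}.

Lemma lexlt_irr u : ~ lexlt u u.
Proof. by case=> k []; rewrite ltnn. Qed.

Lemma lexlt_trans u v w : lexlt u v -> lexlt v w -> lexlt u w.
Proof.
move=> [k [uvk uv]] [l [vwl vw]]; case: (ltngtP k l) => kl.
- by exists k; split=> [|j jk]; [rewrite -vw | rewrite uv // vw // (ltn_trans jk)].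
- by exists l; split=> [|j jl]; [rewrite uv | rewrite uv ?vw // (ltn_trans jl)].
- move: kl => /val_inj kl; subst l; exists k; split=> [|j jk]; last by rewrite uv // vw.
  exact: ltn_trans vwl.
Qed.

Lemma lexlt_add2r w u v : lexlt (u + w)%MM (v + w)%MM <-> lexlt u v.
Proof.
split=> -[k [kk kl]]; exists k.
  split; first by rewrite !mnmDE ltn_add2r in kk.
  by move=> l lk; have := kl l lk; rewrite !mnmDE; exact: addIn.
by split=> [|l lk]; rewrite !mnmDE ?ltn_add2r // kl.
Qed.

End Lex.

Section Lead.
Variables (K : fieldType) (N : nat).
Implicit Types (f g : {mpoly K[N]}) (u v : 'X_{1..N}).

Lemma is_lead_neq0 f u : is_lead f u -> f != 0.
Proof. by case=> fu _; apply: contraTneq fu => ->; rewrite msupp0. Qed.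

(** The order is translation invariant, so [u + v] arises only from the pair [u], [v], and its
    coefficient is a product of two nonzero elements of a field. *)
Lemma is_leadM f g u v : is_lead f u -> is_lead g v -> is_lead (f * g) (u + v)%MM.
Proof.
move=> [fu ltu] [gv ltv].
have le_add a b : a \in msupp f -> b \in msupp g ->
    (a = u /\ b = v) \/ lexlt (a + b)%MM (u + v)%MM.
  move=> /ltu[->|au] /ltv[->|bv]; [by left | right.. ].
  - by rewrite ![(u + _)%MM]addmC; apply/lexlt_add2r.
  - exact/lexlt_add2r.
  apply: (@lexlt_trans _ _ (u + b)%MM); first exact/lexlt_add2r.
  by rewrite ![(u + _)%MM]addmC; apply/lexlt_add2r.
have fgE w : (f * g)@_w =
   \sum_(a <- msupp f) \sum_(b <- msupp g) (f@_a * g@_b *+ (w == (a + b)%MM)).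
  rewrite mpolyME big_allpairs raddf_sum /=; apply: eq_bigr => a _.
  rewrite raddf_sum /=; apply: eq_bigr => b _.
  by rewrite mcoeffZ mcoeffX mulr_natr eq_sym.
split.
- rewrite mcoeff_msupp fgE (bigD1_seq u) //= (bigD1_seq v) //= eqxx mulr1n.
  have other a b : a \in msupp f -> b \in msupp g -> (a != u) || (b != v) ->
      f@_a * g@_b *+ ((u + v)%MM == (a + b)%MM) = 0.
    move=> af bg ab; case: eqVneq => // e.
    case: (le_add a b af bg) => [[au bv]|]; first by rewrite au bv !eqxx in ab.
    by rewrite -e => /lexlt_irr.
  rewrite [X in _ + X + _]big1_seq => [|b /andP[bv bg]]; last by rewrite other ?bv ?orbT.
  rewrite [X in _ + X]big1_seq => [|a /andP[au af]].
    by rewrite !addr0 mulf_neq0 // -mcoeff_msupp.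
  by rewrite big1_seq // => b /andP[_ bg]; rewrite other ?au.
- move=> w /msuppM_le /allpairsP[[a b] /= [af bg ->]].
  by case: (le_add a b af bg) => [[-> ->]|]; [left|right].
Qed.

End Lead.

(** * Products of initial ideals and the easy inclusion *)

Section Init.
Variables (K : fieldType) (N : nat).
Implicit Types (p q r g : {mpoly K[N]}) (G I : {mpoly K[N]} -> Prop).

Lemma init_ideal_lead I f u : I f -> is_lead f u -> init_ideal I 'X_[u].
Proof. by move=> If fu; apply: gen_ideal_mem; exists f, u; rewrite (is_lead_neq0 fu). Qed.

Lemma init_idealM I s p q :
  init_ideal I p -> init_ideal (ideal_pow I s) q ->
  init_ideal (ideal_pow I s.+1) (p * q).
Proof.
move=> Ip Iq; move: p Ip; apply: gen_ideal_ind.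
- by rewrite mul0r; exact: gen_ideal0.
- by move=> a b Ha Hb; rewrite mulrDl; apply: gen_idealD.
move=> r _ [f [u [If [_ [fu ->]]]]]; rewrite -mulrA; apply: gen_idealMl.
move: q Iq; apply: gen_ideal_ind.
- by rewrite mulr0; exact: gen_ideal0.
- by move=> a b Ha Hb; rewrite mulrDr; apply: gen_idealD.
move=> r' _ [g [v [Ig [_ [gv ->]]]]]; rewrite mulrCA; apply: gen_idealMl.
by rewrite -mpolyXD; apply: (init_ideal_lead (ideal_powS If Ig)); exact: is_leadM.
Qed.

Lemma is_lead1 : is_lead (1 : {mpoly K[N]}) 0%MM.
Proof. by split=> [|v]; rewrite msupp1 inE => // /eqP; left. Qed.

Lemma ideal_pow_init I s p :
  ideal_pow (init_ideal I) s p -> init_ideal (ideal_pow I s) p.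
Proof.
apply: gen_ideal_ind.
- exact: gen_ideal0.
- by move=> a b; apply: gen_idealD.
move=> r _ [l [<- [lI ->]]]; apply: gen_idealMl.
elim: l lI => [|q l IHl] lI.
  rewrite big_nil -mpolyX0; apply: init_ideal_lead is_lead1; exact: ideal_pow0.
rewrite big_cons; apply: init_idealM; first exact/lI/mem_head.
by apply: IHl => x xl; apply: lI; rewrite in_cons xl orbT.
Qed.

End Init.

(** * Hasse derivatives *)

Section Hasse.
Variables (K : fieldType) (N : nat) (i : 'I_N).
Implicit Types (f g : {mpoly K[N]}) (u v w : 'X_{1..N}).

(* The substitution x_i := x_i + X, the polynomial variable X being new. *)
Definition shift f : {poly {mpoly K[N]}} :=
  mmap (polyC \o @mpolyC N K) (fun j => ('X_j)%:P + (j == i)%:R *: 'X) f.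

HB.instance Definition _ := GRing.RMorphism.copy shift
  (mmap (polyC \o @mpolyC N K) (fun j => ('X_j)%:P + (j == i)%:R *: 'X)).

(** A partial derivative of order [b] already divided by [b!], hence meaningful in every
    characteristic. *)
Definition hasse (b : nat) f : {mpoly K[N]} := (shift f)`_b.

Lemma hasseD b f g : hasse b (f + g) = hasse b f + hasse b g.
Proof. by rewrite /hasse rmorphD coefD. Qed.

Lemma hasseM b f g : hasse b (f * g) = \sum_(c < b.+1) hasse c f * hasse (b - c) g.
Proof. by rewrite /hasse rmorphM coefM. Qed.

Lemma shiftX u : shift 'X_[u] =
  \sum_(b < (u i).+1) ('X_[u - U_(i) *+ b] *+ 'C(u i, b)) *: 'X^b.
Proof.
rewrite /shift mmapX /mmap1 (bigD1 i) //= eqxx scale1r exprDn mulr_suml.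
apply: eq_bigr => b _; rewrite [in RHS]mpolyXE_id [in RHS](bigD1 i) //= mulrnAl -scalerMnl.
rewrite mnmBE mulmnE mnm1E eqxx mul1n -mul_polyC rmorphM rmorphXn rmorph_prod /=.
rewrite -mulrA [in RHS]mulrAC -mulrA; congr (_ * (_ * _) *+ _).
apply: eq_bigr => j /negbTE ji; rewrite ji scale0r addr0 rmorphXn /=.
by rewrite mnmBE mulmnE mnm1E eq_sym ji mul0n subn0.
Qed.

Lemma hasseX b u : hasse b 'X_[u] = 'X_[u - U_(i) *+ b] *+ 'C(u i, b).
Proof.
rewrite /hasse shiftX coef_sum.
have [bu|ub] := ltnP b (u i).+1.
  rewrite (bigD1 (Ordinal bu)) //= coefZ coefXn eqxx mulr1 big1 ?addr0 // => c.
  by rewrite -val_eqE /= coefZ coefXn eq_sym => /negbTE->; rewrite mulr0.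
rewrite bin_small // mulr0n big1 // => c _.
by rewrite coefZ coefXn gtn_eqF ?mulr0 // (leq_trans (ltn_ord c)).
Qed.

Lemma mcoeff_hasse b f w :
  (hasse b f)@_w = f@_(w + U_(i) *+ b) *+ 'C(w i + b, b).
Proof.
rewrite {1}[f]mpolyE /hasse rmorph_sum coef_sum raddf_sum /=.
rewrite [in RHS](mpolyE f) [in RHS]raddf_sum /= -sumrMnl; apply: eq_bigr => u _.
rewrite -mul_mpolyC rmorphM /= {1}/shift mmapC coefCM mcoeffCM -/(hasse b _).
rewrite hasseX [LHS]mcoeffCM mcoeffMn !mcoeffX -mulrnAr; congr (_ * _).
have [bu|ub] := leqP b (u i); last first.
  rewrite bin_small // mulr0n; case: eqVneq => [e|]; last by rewrite mul0rn.
  by move: ub; rewrite e mnmDE mulmnE mnm1E eqxx mul1n ltnNge leq_addl.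
have -> : (u - U_(i) *+ b == w)%MM = (u == w + U_(i) *+ b)%MM.
  apply/eqP/eqP => [<-|->]; last by rewrite addmK.
  rewrite submK //; apply/mnm_lepP => j; rewrite mulmnE mnm1E.
  by case: eqVneq => [<-|]; rewrite ?mul1n.
case: eqVneq => [->|]; last by rewrite !mul0rn.
by rewrite mnmDE mulmnE mnm1E eqxx mul1n.
Qed.

Lemma hasse0 f : hasse 0 f = f.
Proof. by apply/mpolyP => w; rewrite mcoeff_hasse mulm0n addm0 bin0 mulr1n. Qed.

(** In the Leibniz rule a term that differentiates a factor may lose it from [I], but spends at
    least one order on it; the term of order 0 keeps it. *)
Lemma hasse_prod_pow I b (l : seq {mpoly K[N]}) : (forall q, q \in l -> I q) ->
  ideal_pow I (size l - b) (hasse b (\prod_(q <- l) q)).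
Proof.
elim: l b => [|g l IHl] b lI; first exact: ideal_pow0.
have {}IHl c : ideal_pow I (size l - c) (hasse c (\prod_(q <- l) q)).
  by apply: IHl => q ql; apply: lI; rewrite in_cons ql orbT.
rewrite big_cons hasseM big_ord_recl subn0 hasse0; apply: gen_idealD.
  apply: (ideal_pow_le (s := (size l - b).+1)); first by rewrite /=; lia.
  by apply: ideal_powS; [exact/lI/mem_head | exact: IHl].
apply: gen_ideal_sum => c _; apply: gen_idealMl; apply: ideal_pow_le (IHl _).
by rewrite /= /bump leq0n; have := ltn_ord c; lia.
Qed.

Lemma hasse_pow I s b f : ideal_pow I s f -> ideal_pow I (s - b) (hasse b f).
Proof.
apply: (gen_ideal_ind (P := fun f => ideal_pow I (s - b) (hasse b f))).
- by rewrite /hasse rmorph0 coef0; exact: gen_ideal0.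
- by move=> p q Hp Hq; rewrite (hasseD b p q); exact: gen_idealD Hp Hq.
move=> r _ [l [<- [lI ->]]]; rewrite hasseM; apply: gen_ideal_sum => c _.
by apply: gen_idealMl; apply: ideal_pow_le (hasse_prod_pow (b - c) lI); lia.
Qed.

(** The order is the full exponent of the variable in [u], so the binomial factor at the leading
    term is 1 and cannot vanish in positive characteristic. *)
Lemma hasse_lead f u : is_lead f u ->
  is_lead (hasse (u i) f) (u - U_(i) *+ u i)%MM.
Proof.
have Ule v : (U_(i) *+ v i <= v)%MM.
  by apply/mnm_lepP => j; rewrite mulmnE mnm1E; case: eqVneq => [<-|]; rewrite ?mul1n.
move=> [fu ltu]; split.
  rewrite mcoeff_msupp mcoeff_hasse submK //.
  by rewrite mnmBE mulmnE mnm1E eqxx mul1n subnn add0n binn mulr1n -mcoeff_msupp.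
move=> w; rewrite mcoeff_msupp mcoeff_hasse => wf.
have /ltu : (w + U_(i) *+ u i)%MM \in msupp f.
  by rewrite mcoeff_msupp; apply: contraNneq wf => ->; rewrite mul0rn.
case=> [e|lt]; [left | right]; first by rewrite -[w](addmK (U_(i) *+ u i)%MM) e.
by apply/(lexlt_add2r (U_(i) *+ u i)%MM); rewrite submK.
Qed.

End Hasse.

(** * Koenig's theorem with vertex weights *)

Section Konig.
Local Open Scope nat_scope.
Variables (V : finType) (side : pred V) (e : rel V).
Hypothesis e_side : forall x y, e x y -> side x && ~~ side y.
Implicit Types (C D : {set V}) (u : V -> nat) (x y : V).

Definition is_cover C := [forall x, forall y, e x y ==> (x \in C) || (y \in C)].

Lemma is_coverP C :
  reflect (forall x y, e x y -> (x \in C) || (y \in C)) (is_cover C).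
Proof.
apply: (iffP forallP) => cC x; first by move=> y; have /forallP/(_ y)/implyP := cC x.
by apply/forallP => y; apply/implyP/cC.
Qed.

Definition weight u C := \sum_(x in C) u x.

(** Covers of a bipartite graph form a lattice: intersect on one side, unite on the other. *)
Definition cover_meet C D :=
  [set x | if side x then (x \in C) && (x \in D) else (x \in C) || (x \in D)].
Definition cover_join C D :=
  [set x | if side x then (x \in C) || (x \in D) else (x \in C) && (x \in D)].

Lemma cover_meetP C D : is_cover C -> is_cover D -> is_cover (cover_meet C D).
Proof.
move=> /is_coverP cC /is_coverP cD; apply/is_coverP => x y xy.
have /andP[xs /negbTE ys] := e_side xy.
rewrite !inE xs ys; have := cC _ _ xy; have := cD _ _ xy.
by do 4 case: (_ \in _).
Qed.

Lemma cover_joinP C D : is_cover C -> is_cover D -> is_cover (cover_join C D).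
Proof.
move=> /is_coverP cC /is_coverP cD; apply/is_coverP => x y xy.
have /andP[xs /negbTE ys] := e_side xy.
rewrite !inE xs ys; have := cC _ _ xy; have := cD _ _ xy.
by do 4 case: (_ \in _).
Qed.

Lemma weight_meet_join u C D :
  weight u (cover_meet C D) + weight u (cover_join C D) = weight u C + weight u D.
Proof.
rewrite /weight ![\sum_(_ in _) _]big_mkcond -!big_split; apply: eq_bigr => x _ /=.
by rewrite !inE; case: side; case: (x \in C); case: (x \in D) => /=; lia.
Qed.

Section MinCover.
Variables (u : V -> nat) (t : nat).
Hypothesis tP : forall C, is_cover C -> t <= weight u C.

Definition is_mincover C := is_cover C && (weight u C == t).

(** Meet and join weigh at least [t] each and [2t] together. *)
Lemma meet_mincover C D :
  is_mincover C -> is_mincover D -> is_mincover (cover_meet C D).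
Proof.
move=> /andP[cC /eqP wC] /andP[cD /eqP wD].
have cM := cover_meetP cC cD; rewrite /is_mincover cM /=; apply/eqP.
have := tP cM; have := tP (cover_joinP cC cD); have := weight_meet_join u C D; lia.
Qed.

(* Otherwise replacing x by its neighbours yields a lighter cover. *)
Lemma mincover_nbr C x : is_mincover C -> x \in C -> 0 < u x ->
  exists y, [/\ e x y || e y x, y \notin C & 0 < u y].
Proof.
move=> /andP[/is_coverP cC /eqP wC] xC ux.
have [/existsP[y /and3P[]]|] :=
    boolP [exists y, [&& e x y || e y x, y \notin C & 0 < u y]].
  by exists y.
rewrite negb_exists => /forallP none.
pose D := (C :\ x) :|: [set y | e x y || e y x].
have cD : is_cover D.
  apply/is_coverP => a b ab; rewrite !inE; have [ax|ax] := eqVneq a x.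
    by subst a; rewrite ab !orbT.
  have [bx|bx] := eqVneq b x; first by subst b; rewrite ab !orbT.
  by case/orP: (cC _ _ ab) => ->; rewrite ?orbT.
suff : weight u D < t by rewrite ltnNge tP.
rewrite -wC {2}/weight (bigD1 x) //=; set rest := (X in _ + X).
(* [D] avoids [x], as no edge is a loop, and its vertices outside [C] have weight 0 by [none]. *)
suff : weight u D <= rest by lia.
rewrite /weight /rest big_mkcond [X in _ <= X]big_mkcond /=.
have xx : e x x = false by apply/negP => /[dup] /e_side /andP[-> /negP].
apply: leq_sum => y _; rewrite !inE.
have := none y; have [->|yx] := eqVneq y x; first by rewrite xx.
rewrite /= andbT; case: (y \in C) => //=; case: (_ || _) => //=; lia.
Qed.

Definition side_weight C := weight u (C :&: [set x | side x]).

Lemma weight_gt0 C : 0 < weight u C -> exists2 x, x \in C & 0 < u x.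
Proof.
rewrite lt0n sum_nat_eq0 negb_forall => /existsP[x].
by rewrite negb_imply -lt0n => /andP[]; exists x.
Qed.

Lemma leq_weight C x : x \in C -> u x <= weight u C.
Proof. by move=> xC; rewrite /weight (bigD1 x xC) leq_addr. Qed.

(* A minimum cover C of least positive side weight works: if x in C lies on the
   side, it has a neighbour y outside C, and a minimum cover D containing both
   x and y would make the meet of C and D have smaller side weight. *)
Lemma exists_tight_edge C0 : is_mincover C0 -> 0 < t ->
  exists x y, [/\ e x y, 0 < u x, 0 < u y &
    forall D, is_mincover D -> ~~ ((x \in D) && (y \in D))].
Proof.
move=> mC0 t0.
have [/existsP[C1 pC1]|] := boolP [exists C, is_mincover C && (0 < side_weight C)].
  case: (@arg_minnP _ C1 (fun C => is_mincover C && (0 < side_weight C)) side_weight pC1) => C /andP[mC wC] minC.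
  have [x] := weight_gt0 wC; rewrite !inE => /andP[xC xs] ux.
  have [y [xy yC uy]] := mincover_nbr mC xC ux.
  have {}xy : e x y by case/orP: xy => // /e_side; rewrite xs andbF.
  exists x, y; split=> // D mD; apply/andP => -[xD yD].
  have /andP[_ /negbTE ys] := e_side xy.
  have mM := meet_mincover mC mD.
  have : side_weight C <= side_weight (cover_meet C D).
    apply: minC; rewrite mM; apply: leq_trans ux _; apply: leq_weight.
    by rewrite !inE xs xC xD.
  have wE E : is_cover E -> weight u E =
      side_weight E + weight u (E :\: [set x | side x]).
    by move=> _; rewrite /side_weight /weight -big_setID.
  move: mM mC => /andP[cM /eqP wM] /andP[cC /eqP wC'].
  rewrite -{}wC' in wM; rewrite (wE _ cM) (wE _ cC) in wM.
  (* Both covers have total weight [t] and the side weight has not dropped, so any gain off the side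
     is contradictory; the meet gains [y]. *)
  suff : weight u (C :\: [set x | side x]) <
         weight u (cover_meet C D :\: [set x | side x]) by lia.
  rewrite {2}/weight (bigD1 y) ?inE ?ys ?yD ?orbT //=.
  rewrite -[X in X < _]add0n -addSn leq_add // /weight big_mkcond [X in _ <= X]big_mkcond /=.
  apply: leq_sum => z _; rewrite !inE; case: (side z) => //=.
  by case: ifP => // zC; case: eqVneq => //= zy; rewrite zy (negbTE yC) in zC.
(* Otherwise minimum covers contain no vertex of positive weight on the side. A vertex [y] of [C0]
   of positive weight then has a neighbour [x] on the side that no minimum cover contains. *)
rewrite negb_exists => /forallP noside.
have side0 C : is_mincover C -> side_weight C = 0.
  by move=> mC; have := noside C; rewrite mC /= lt0n negbK => /eqP.
have side_notin C x : is_mincover C -> side x -> 0 < u x -> x \notin C.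
  move=> mC xs ux; apply/negP => xC; move: ux; rewrite lt0n -leqn0 -(side0 C mC).
  by rewrite leq_weight // !inE xC.
have [y yC uy] : exists2 y, y \in C0 & 0 < u y.
  by apply: weight_gt0; case/andP: mC0 => _ /eqP->.
have [x [xy xC ux]] := mincover_nbr mC0 yC uy.
have yx : e x y.
  by case/orP: xy => // /e_side/andP[ys _]; rewrite (negbTE (side_notin _ _ mC0 ys uy)) in yC.
exists x, y; split=> // D mD; apply/negP => /andP[xD _].
by have /andP[xs _] := e_side yx; have := side_notin _ _ mD xs ux; rewrite xD.
Qed.

End MinCover.

(** Induction on [t]: lower the weights by 1 at both ends of an edge such that no cover of weight
    [t.+1] contains both ends. Such covers lose at most 1 and heavier ones at most 2, so all still
    weigh at least [t]. *)
Lemma konig u t : (forall C, is_cover C -> t <= weight u C) ->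
  exists s : seq (V * V), [/\ size s = t, forall p, p \in s -> e p.1 p.2 &
    forall x, \sum_(p <- s) ((p.1 == x) + (p.2 == x)) <= u x].
Proof.
elim: t u => [|t IHt] u tP; first by exists [::]; split=> // x; rewrite big_nil.
have [x [y [xy ux uy dbl]]] : exists x y, [/\ e x y, 0 < u x, 0 < u y &
    forall D, is_cover D -> weight u D = t.+1 -> ~~ ((x \in D) && (y \in D))].
  have [/existsP[C mC]|] := boolP [exists C, is_mincover u t.+1 C].
    have [x [y [xy ux uy dbl]]] := exists_tight_edge tP mC isT.
    exists x, y; split=> // D cD wD; apply: dbl.
    by rewrite /is_mincover cD wD eqxx.
  (* With no cover of weight [t.+1], any edge with ends of positive weight will do; without such an
     edge the vertices of weight 0 would form a cover. *)
  rewrite negb_exists => /forallP nomin.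
  have [/existsP[x /existsP[y /and3P[xy ux uy]]]|] :=
      boolP [exists x, exists y, [&& e x y, 0 < u x & 0 < u y]].
    exists x, y; split=> // D cD wD; have := nomin D.
    by rewrite /is_mincover cD wD eqxx.
  rewrite negb_exists => /forallP noe.
  suff cZ : is_cover [set x | u x == 0].
    by have := tP _ cZ; rewrite /weight big1 // => x; rewrite inE => /eqP.
  apply/is_coverP => x y xy; rewrite !inE; have := noe x; rewrite negb_exists.
  by move=> /forallP/(_ y); rewrite xy /= negb_and -!eqn0Ngt.
have xNy : x != y by apply: contraTneq xy => ->; apply/negP => /[dup] /e_side /andP[->].
pose u' z := u z - ((z == x) + (z == y)).
have uE z : u z = u' z + ((z == x) + (z == y)).
  rewrite /u' subnK //; have [->|_] := eqVneq z x; first by rewrite (negbTE xNy).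
  by case: eqVneq => // ->.
have wE D : weight u D = weight u' D + ((x \in D) + (y \in D)).
  have one z : \sum_(w in D) (w == z : nat) = (z \in D).
    have [zD|zD] := boolP (z \in D); last first.
      by rewrite big1 // => w wD; case: eqVneq wD => // ->; rewrite (negbTE zD).
    by rewrite (bigD1 z) //= eqxx big1 // => w /andP[_ /negbTE->].
  by rewrite -!one -!big_split /=; apply: eq_bigr => z _; exact: uE.
have [D cD|s [sz se su]] := IHt u'.
  have := tP D cD; have := dbl D cD; rewrite wE.
  by case: (x \in D); case: (y \in D) => /=; lia.
exists ((x, y) :: s); split=> [|p|z]; first by rewrite /= sz.
  by rewrite in_cons => /predU1P[->|/se].
by rewrite big_cons uE addnC leq_add // ![_ == z]eq_sym.
Qed.

End Konig.

(** * Adjacent minors *)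

Section Path.
Variables (m n : nat).
Implicit Types (u v w : 'X_{1..m * n}) (x y : 'I_(m * n)).

Lemma vidx_col_gt0 x : (0 < n)%N.
Proof. by have := ltn_ord x; case: posnP => // n0; rewrite {2}n0 muln0. Qed.

Lemma vidx_row_proof x : (x %/ n < m)%N.
Proof. by rewrite ltn_divLR ?(vidx_col_gt0 x). Qed.

Lemma vidx_col_proof x : (x %% n < n)%N.
Proof. by rewrite ltn_mod (vidx_col_gt0 x). Qed.

Definition vrow x := Ordinal (vidx_row_proof x).
Definition vcol x := Ordinal (vidx_col_proof x).

Lemma vidxK x : vidx (vrow x) (vcol x) = x.
Proof. by apply: val_inj; rewrite /= -divn_eq. Qed.

Lemma vrowK (i : 'I_m) (k : 'I_n) : vrow (vidx i k) = i.
Proof.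
by apply: val_inj; rewrite /= divnMDl ?(leq_ltn_trans _ (ltn_ord k)) // divn_small ?addn0.
Qed.

Lemma vcolK (i : 'I_m) (k : 'I_n) : vcol (vidx i k) = k.
Proof. by apply: val_inj; rewrite /= modnMDl modn_small. Qed.

Lemma vidx_inj (i j : 'I_m) (k l : 'I_n) : vidx i k = vidx j l -> i = j /\ k = l.
Proof.
by move=> e; split; [rewrite -(vrowK i k) e vrowK | rewrite -(vcolK i k) e vcolK].
Qed.

Definition edge : rel 'I_(m * n) :=
  [rel x y | (vrow x < vrow y)%N && (vcol y == (vcol x).+1 :> nat)].

Lemma edgeE (i j : 'I_m) (k l : 'I_n) :
  edge (vidx i k) (vidx j l) = (i < j)%N && (l == k.+1 :> nat).
Proof. by rewrite /edge -[LHS]/(_ && _) !vrowK !vcolK. Qed.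

Definition coldeg u (k : 'I_n) := (\sum_(i < m) u (vidx i k))%N.
Definition rowdeg u (i : 'I_m) (c : nat) := (\sum_(k < n | (k < c)%N) u (vidx i k))%N.

(* A minor of columns k, k+1 cannot change a row sum over the columns < c when
   column c is empty, since then k+1 <> c. *)
Definition cut u (c : nat) := (c == n) || [exists k : 'I_n, (k == c :> nat) && (coldeg u k == 0)%N].

(** The cuts are those of [u], but equal column degrees give [v] the same ones. The range ['I_n.+1]
    admits [c = n], where full row degrees are compared. *)
Definition similar u v :=
  [forall k, coldeg v k == coldeg u k] &&
  [forall i, forall c : 'I_n.+1, cut u c ==> (rowdeg v i c == rowdeg u i c)].

Lemma similar_refl u : similar u u.
Proof.
apply/andP; split; apply/forallP => i; first exact: eqxx.
by apply/forallP => c; apply/implyP => _; exact: eqxx.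
Qed.

Definition standard u := forall x y, edge x y -> (u x == 0)%N || (u y == 0)%N.

(** At the first variable [x_{i,k}] where they differ, [v] would be smaller. Before the next cut
    [c], row [i] of [v] must make up for this in some column [k']; as [u] has nothing below row [i]
    there, column [k'] of [v] is too heavy. *)
Lemma similar_standard u v : standard u -> similar u v -> ~ lexlt v u.
Proof.
move=> std /andP[/forallP colE /forallP rowE] [x []].
rewrite -[x]vidxK; move: (vrow x) (vcol x) => i k {x} vux vuE.
have ltx (j : 'I_m) (l : 'I_n) : (j < i)%N || ((j == i) && (l < k))%N -> v (vidx j l) = u (vidx j l).
  move=> jl; apply: vuE; rewrite /=.
  case/orP: jl => [ji|/andP[/eqP-> lk]]; last by rewrite ltn_add2l.
  have := ltn_ord l; have : (j.+1 * n <= i * n)%N by rewrite leq_mul2r ji orbT.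
  by rewrite mulSn; lia.
have exc : exists c : nat, [&& (k < c)%N, (c <= n)%N & cut u c].
  by exists n; rewrite ltn_ord leqnn /cut eqxx.
case: (ex_minnP exc) => c /and3P[kc cn cutc] minc.
have /forallP/(_ (Ordinal (cn : (c < n.+1)%N)))/implyP/(_ cutc)/eqP /= rowc := rowE i.
have [k' kk' vk'] : exists2 k' : 'I_n, (k < k' < c)%N & (u (vidx i k') < v (vidx i k'))%N.
  apply/exists_inP; apply: contraPT rowc; rewrite negb_exists_in => /forall_inP nok.
  rewrite /rowdeg (bigD1 k) //= [in RHS](bigD1 k) //= => rowc.
  suff : (\sum_(l < n | (l < c)%N && (l != k)) v (vidx i l) <=
          \sum_(l < n | (l < c)%N && (l != k)) u (vidx i l))%N.
    by move=> le; move: (leq_add vux le); rewrite addSn rowc ltnn.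
  apply: leq_sum => l /andP[lc lk]; case: (ltngtP l k) => [lk'|kl|/val_inj lk'].
  - by rewrite ltx // eqxx lk' orbT.
  - by rewrite leqNgt nok // kl.
  - by rewrite lk' eqxx in lk.
(* Induction on the distance from column [k], where [u] is positive in row [i]. Columns strictly
   between [k] and [c] are nonempty in [u], and an entry in a row at most [i] excludes entries below
   row [i] in the next column. *)
have low d (l : 'I_n) : l = (k + d.+1)%N :> nat -> (l < c)%N ->
    forall j : 'I_m, (i < j)%N -> u (vidx j l) = 0%N.
  elim: d l => [|d IHd] l le lc j ij.
    have /std/orP[|/eqP//] : edge (vidx i k) (vidx j l).
      by rewrite edgeE ij le addn1 eqxx.
    by move=> /eqP ux; rewrite ux in vux.
  have l'n : (k + d.+1 < n)%N by have := ltn_ord l; lia.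
  pose l' := Ordinal l'n.
  have : coldeg u l' != 0%N.
    apply/negP => u0; have := minc l'; rewrite /= /cut.
    have -> : [exists k0 : 'I_n, (k0 == k + d.+1 :> nat)%N && (coldeg u k0 == 0)%N].
      by apply/existsP; exists l'; rewrite eqxx.
    by rewrite orbT andbT; lia.
  rewrite sum_nat_eq0 negb_forall => /existsP[j' /=] uj'.
  have j'i : (j' <= i)%N.
    rewrite leqNgt; apply: contra uj' => /(IHd l') -> //; rewrite /=; lia.
  have /std/orP[|/eqP//] : edge (vidx j' l') (vidx j l).
    by rewrite edgeE (leq_ltn_trans j'i) // le addnS eqxx.
  by rewrite (negbTE uj').
have := colE k'; apply/negP; rewrite neq_ltn; apply/orP; right.
rewrite /coldeg (bigD1 i) //= [X in (_ < X)%N](bigD1 i) //=.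
rewrite -addSn leq_add // leq_sum // => j ji.
case: (ltngtP j i) => [lt_ji|lt_ij|/val_inj]; last by move=> e; rewrite e eqxx in ji.
  by rewrite ltx ?lt_ji.
have /andP[lk' lc'] := kk'.
by rewrite (low (k' - k.+1)%N) //; lia.
Qed.

End Path.

(** * Summing coefficients over a class of monomials *)

Section CoeffSum.
Variables (K : fieldType) (N : nat) (P : pred 'X_{1..N}).
Implicit Types p q : {mpoly K[N]}.

Definition coeff_sum p := \sum_(v <- msupp p | P v) p@_v.

Lemma coeff_sum_supp p s : uniq s -> {subset msupp p <= s} ->
  coeff_sum p = \sum_(v <- s | P v) p@_v.
Proof.
move=> us sub; rewrite [RHS](bigID (mem (msupp p))) /=.
rewrite [X in _ = _ + X]big1 ?addr0 => [|v /andP[_ vp]]; last exact: memN_msupp_eq0.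
rewrite /coeff_sum; under eq_bigl => v do rewrite andbC.
rewrite -big_filter_cond; apply: perm_big; apply: uniq_perm => [||v].
- exact: msupp_uniq.
- exact: filter_uniq.
by rewrite mem_filter; case: (boolP (v \in msupp p)) => // /sub ->.
Qed.

Lemma coeff_sumD p q : coeff_sum (p + q) = coeff_sum p + coeff_sum q.
Proof.
pose s := undup (msupp p ++ msupp q).
have us : uniq s by exact: undup_uniq.
rewrite !(@coeff_sum_supp _ s us).
- by rewrite -big_split; apply: eq_bigr => v _; rewrite mcoeffD.
- by move=> v vq; rewrite mem_undup mem_cat vq orbT.
- by move=> v vp; rewrite mem_undup mem_cat vp.
- by move=> v /msuppD_le; rewrite mem_undup.
Qed.

Lemma coeff_sum0 : coeff_sum 0 = 0.
Proof. by rewrite /coeff_sum msupp0 big_nil. Qed.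

Lemma coeff_sumZ c p : coeff_sum (c *: p) = c * coeff_sum p.
Proof.
rewrite (@coeff_sum_supp _ (msupp p)) ?msupp_uniq //; last exact: msuppZ_le.
by rewrite mulr_sumr; apply: eq_bigr => v _; rewrite mcoeffZ.
Qed.

Lemma coeff_sumX v : coeff_sum 'X_[v] = (P v)%:R.
Proof. by rewrite /coeff_sum msuppX big_mkcond big_seq1 mcoeffX eqxx; case: (P v). Qed.

(** After multiplication by any monomial the two terms lie both inside or both outside the class, so
    they cancel. *)
Lemma coeff_sum_binomial r a b : (forall w, P (w + a)%MM = P (w + b)%MM) ->
  coeff_sum (r * ('X_[a] - 'X_[b])) = 0.
Proof.
move=> ab; rewrite [r]mpolyE mulr_suml.
elim/big_rec: _ => [|w x _ x0]; first exact: coeff_sum0.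
rewrite coeff_sumD x0 addr0 -scalerAl coeff_sumZ mulrBr -!mpolyXD.
rewrite coeff_sumD -scaleN1r coeff_sumZ !coeff_sumX ab.
by rewrite mulN1r subrr mulr0.
Qed.

End CoeffSum.

(** * The Groebner basis property and leading monomials of powers *)

Section Groebner.
Variables (K : fieldType) (m n : nat).
Implicit Types (u v w : 'X_{1..m * n}) (x y : 'I_(m * n)).

Lemma coldegD u v k : coldeg (u + v)%MM k = (coldeg u k + coldeg v k)%N.
Proof. by rewrite /coldeg -big_split; apply: eq_bigr => i _; rewrite mnmDE. Qed.

Lemma rowdegD u v i c : rowdeg (u + v)%MM i c = (rowdeg u i c + rowdeg v i c)%N.
Proof. by rewrite /rowdeg -big_split; apply: eq_bigr => k _; rewrite mnmDE. Qed.

Lemma vidx_eq (i j : 'I_m) (k l : 'I_n) : (vidx i k == vidx j l) = (i == j) && (k == l).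
Proof. by apply/eqP/andP => [/vidx_inj[-> ->]|[/eqP-> /eqP->]]. Qed.

Lemma coldeg1 (i : 'I_m) (k l : 'I_n) : coldeg U_(vidx i k)%MM l = (k == l).
Proof.
rewrite /coldeg (bigD1 i) //= mnm1E vidx_eq eqxx big1 ?addn0 // => j /negbTE ji.
by rewrite mnm1E vidx_eq eq_sym ji.
Qed.

Lemma rowdeg1 (i j : 'I_m) (k : 'I_n) c :
  rowdeg U_(vidx i k)%MM j c = ((i == j) && (k < c)%N).
Proof.
rewrite /rowdeg big_mkcond (bigD1 k) //= mnm1E vidx_eq eqxx andbT big1 => [|l /negbTE lk].
  by rewrite addn0; case: (i == j); case: ltnP.
by rewrite mnm1E vidx_eq [k == l]eq_sym lk andbF if_same.
Qed.

(** Only row sums over the columns before [k] may differ, and [k] is not a cut of [u]: column [k] is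
    nonempty in [v], hence in [u]. *)
Lemma similar_switch u v v' (k : 'I_n) :
  (forall l, coldeg v l = coldeg v' l) -> (0 < coldeg v k)%N ->
  (forall i (c : nat), c != k -> rowdeg v i c = rowdeg v' i c) -> similar u v -> similar u v'.
Proof.
move=> col k0 row /andP[/forallP colE /forallP rowE]; apply/andP; split.
  by apply/forallP => l; rewrite -col.
apply/forallP => i; apply/forallP => c; apply/implyP => cutc.
have /forallP/(_ c)/implyP/(_ cutc) := rowE i; have [ck|] := eqVneq (c : nat) k; last first.
  by move=> ck; rewrite (row i c ck).
case/orP: cutc => [|/existsP[l /andP[/eqP lc /eqP ul]]].
  by rewrite ck ltn_eqF.
have lk : l = k by apply: val_inj; rewrite /= lc.
by move: k0; rewrite (eqP (colE k)) -lk ul.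
Qed.

Lemma J_lead_nonstandard f u : J_KP K m n f -> is_lead f u -> ~ standard u.
Proof.
move=> Jf [fu ltu] std.
suff : coeff_sum (similar u) f = 0.
  rewrite /coeff_sum big_mkcond (bigD1_seq u) ?msupp_uniq //= similar_refl.
  (* The other monomials of [f] are lex smaller than [u], so none lies in its class. *)
  rewrite big1_seq ?addr0 => [/eqP|v /andP[vu /ltu[e|vltu]]].
  - by apply/negP; rewrite -mcoeff_msupp.
  - by rewrite e eqxx in vu.
  - by case: ifP => // uv; case: (similar_standard std uv).
move: f Jf {fu ltu}; apply: gen_ideal_ind.
- exact: coeff_sum0.
- by move=> p q p0 q0; rewrite coeff_sumD p0 q0 addr0.
move=> r _ [i [j [k [k1 [ij [kk1 ->]]]]]].
rewrite /xv -!mpolyXD; apply: coeff_sum_binomial => w.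
have col l : coldeg (w + (U_(vidx i k) + U_(vidx j k1)))%MM l =
             coldeg (w + (U_(vidx i k1) + U_(vidx j k)))%MM l.
  by rewrite !coldegD !coldeg1 [X in (_ + X)%N]addnC.
(* [k < c] and [k1 < c] differ only at [c = k1]. *)
have row i0 (c : nat) : c != k1 -> rowdeg (w + (U_(vidx i k) + U_(vidx j k1)))%MM i0 c =
             rowdeg (w + (U_(vidx i k1) + U_(vidx j k)))%MM i0 c.
  move=> ck1; rewrite !rowdegD !rowdeg1; have -> // : (k < c)%N = (k1 < c)%N.
  by move: ck1; rewrite kk1; lia.
apply/idP/idP; apply: (@similar_switch _ _ _ k1) => //.
- by rewrite !coldegD !coldeg1 eqxx; lia.
- by rewrite !coldegD !coldeg1 eqxx; lia.
- by move=> i0 c ck; rewrite (row i0 c ck).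
Qed.

(** The variables of [l] are erased from the leading monomial one at a time by Hasse derivatives;
    each costs [v x], at most [u x], in the power of [I]. *)
Lemma pow_lead_restrict I s (f : {mpoly K[m * n]}) u (l : seq 'I_(m * n)) :
  ideal_pow I s f -> is_lead f u ->
  exists g v, [/\ ideal_pow I (s - \sum_(x <- l) u x) g, is_lead g v,
    (v <= u)%MM & forall x, x \in l -> v x = 0%N].
Proof.
move=> If fu; elim: l => [|x l [g [v [Ig gv vu v0]]]].
  by exists f, u; rewrite big_nil subn0; split=> //; exact: lepm_refl.
exists (hasse x (v x) g), (v - U_(x) *+ v x)%MM; split.
- apply: (ideal_pow_le (s := (s - \sum_(x <- l) u x - v x)%N)); last exact: hasse_pow.
  by rewrite big_cons; have /mnm_lepP/(_ x) := vu; lia.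
- exact: hasse_lead.
- by apply: lepm_trans vu; exact: lem_subr.
move=> y; rewrite in_cons mnmBE mulmnE mnm1E => /predU1P[->|/v0->//].
by rewrite eqxx mul1n subnn.
Qed.

Lemma lead_pow_weight t f u (C : {set 'I_(m * n)}) :
  (forall x y, edge x y -> (x \in C) || (y \in C)) ->
  ideal_pow (J_KP K m n) t f -> is_lead f u -> (t <= weight u C)%N.
Proof.
move=> cC Jf fu; rewrite leqNgt; apply/negP => wt.
have [g [v [Jg gv _ v0]]] := pow_lead_restrict (enum C) Jf fu.
(* Since [weight u C < t], the remaining power is positive. *)
have Jg1 : J_KP K m n g.
  by apply: ideal_pow_sub Jg; rewrite big_enum subn_gt0.
apply: (J_lead_nonstandard Jg1 gv) => x y /cC.
by rewrite -![_ \in C]mem_enum => /orP[] /v0 ->; rewrite ?eqxx ?orbT.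
Qed.

(** The largest of the four variables is [x_{i,k}], and it occurs only in the first term. *)
Lemma minor_lead (i j : 'I_m) (k k1 : 'I_n) : (i < j)%N -> k1 = k.+1 :> nat ->
  is_lead (xv K m n i k * xv K m n j k1 - xv K m n i k1 * xv K m n j k)
    (U_(vidx i k) + U_(vidx j k1))%MM.
Proof.
move=> ij kk1; rewrite /xv -!mpolyXD.
set a := (_ + _)%MM; set b := (_ + _)%MM.
have ba : lexlt b a.
  exists (vidx i k); split=> [|l lk].
    rewrite !mnmDE !mnm1E !vidx_eq !eqxx.
    have -> : (k1 == k) = false by rewrite -val_eqE /= kk1; lia.
    have -> : (j == i) = false by rewrite -val_eqE /=; lia.
    by rewrite andbF.
  have ne x : (l < vidx i k <= x)%N -> (x : nat) == l = false by lia.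
  rewrite !mnmDE !mnm1E -!val_eqE !ne //; rewrite lk /= ?kk1; nia.
have ab : a != b by apply: contraPneq ba => ->; exact: lexlt_irr.
split=> [|v].
  by rewrite mcoeff_msupp mcoeffB !mcoeffX eqxx [b == a]eq_sym (negbTE ab) subr0 oner_eq0.
move=> /msuppB_le; rewrite mem_cat !msuppX !inE => /orP[] /eqP->; first by left.
by right.
Qed.

Lemma edge_init x y : edge x y -> init_ideal (J_KP K m n) 'X_[U_(x) + U_(y)].
Proof.
rewrite -[x]vidxK -[y]vidxK edgeE => /andP[ij /eqP kk1].
apply: init_ideal_lead (minor_lead ij kk1); apply: gen_ideal_mem.
by exists (vrow x), (vrow y), (vcol x), (vcol y).
Qed.

Lemma lead_in_pow_init t f u : ideal_pow (J_KP K m n) t f -> is_lead f u ->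
  ideal_pow (init_ideal (J_KP K m n)) t 'X_[u].
Proof.
move=> Jf fu.
pose side x := ~~ odd (vcol x).
(* Each edge is oriented from its even column to its odd one, to fit the bipartite form of Koenig's
   theorem. *)
pose e : rel 'I_(m * n) := [rel x y | (edge x y || edge y x) && side x].
have e_side x y : e x y -> side x && ~~ side y.
  by rewrite /e /side => /andP[/orP[] /andP[_ /eqP->] /= ]; rewrite ?negbK => ->.
have [|s [sz se su]] := @konig _ side e e_side u t.
  move=> C /is_coverP cC; apply: lead_pow_weight Jf fu => x y xy.
  have [xs|xs] := boolP (side x); first by apply: cC; rewrite /e /= xy xs.
  rewrite orbC; apply: cC; rewrite /e /= xy orbT /=.
  by have /andP[_ /eqP] := xy; rewrite /side => -> /=.
pose g (p : 'I_(m * n) * 'I_(m * n)) := (U_(p.1) + U_(p.2))%MM.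
have gu : ((\big[mnm_add/0%MM]_(p <- s) g p) <= u)%MM.
  apply/mnm_lepP => x; rewrite mnm_sumE; apply: leq_trans (su x).
  by apply: leq_sum => p _; rewrite mnmDE !mnm1E.
rewrite -(submK gu) mpolyXD; apply/gen_idealMl/gen_ideal_mem.
exists [seq 'X_[g p] | p <- s]; rewrite size_map sz; split=> //; split.
  move=> q /mapP[p ps ->]; have /andP[/orP[]] := se _ ps; first by move/edge_init.
  by rewrite /g addmC; move/edge_init.
by rewrite big_map -(big_map g xpredT (fun w => 'X_[w])) mpolyX_prod big_map.
Qed.

End Groebner.

Theorem theorem3p5 (K : fieldType) (m n : nat) :
  (2 <= m)%N -> (2 <= n)%N ->
  forall t : nat, (1 <= t)%N ->
  forall p : {mpoly K[m * n]},
    ideal_pow (init_ideal (J_KP K m n)) t p <-> init_ideal (ideal_pow (J_KP K m n) t) p.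
Proof.
move=> _ _ t _ p; split; first exact: ideal_pow_init.
(* For the reverse inclusion only leading monomials, which generate the initial ideal, need
   checking. *)
move: p; apply: gen_ideal_ind.
- exact: gen_ideal0.
- by move=> p q; apply: gen_idealD.
move=> r _ [f [u [Jf [_ [fu ->]]]]]; apply: gen_idealMl.
exact: lead_in_pow_init Jf fu.
Qed.
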